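(* Let $\mathbb{V}$ be a finite-dimensional non-zero vector space over a field $\mathbb{F}$ with basis $\{\alpha_1,\ldots,\alpha_n\}$. Then the independence number of the non-zero component graph $\Gamma(\mathbb{V}_\alpha)$ is equal to $\dim_{\mathbb{F}}(\mathbb{V})$.
   Context: Let $\theta$ be the null vector of $\mathbb{V}$. Every $\mathbf{a}\in\mathbb{V}$ is written uniquely as $\mathbf{a}=a_1\alpha_1+\cdots+a_n\alpha_n$ with $a_i\in\mathbb{F}$. The non-zero component graph $\Gamma(\mathbb{V}_\alpha)$ with respect to the basis $\{\alpha_1,\ldots,\alpha_n\}$ is the simple graph with vertex set $\mathbb{V}\setminus\{\theta\}$ in which two distinct vertices $\mathbf{a},\mathbf{b}$ are adjacent if and only if there is an index $i$ with $a_i\neq 0$ and $b_i\neq 0$. The field may be finite or infinite. A set of vertices is independent if its elements are pairwise non-adjacent; the independence number is the maximum size of an independent set. *)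

(* Defs.v *)
From mathcomp Require Import all_boot all_order all_algebra.
From mathcomp Require Import classical_sets cardinality.

Set Implicit Arguments.
Unset Strict Implicit.
Unset Printing Implicit Defensive.

Import GRing.Theory.
Local Open Scope ring_scope.
Local Open Scope classical_set_scope.
Local Open Scope card_scope.

Record sgraph := SGraph {
  vertex :> Type;
  adj : rel vertex;
  adj_sym : symmetric adj;
  adj_irrefl : irreflexive adj
}.

Definition independent (G : sgraph) (S : set G) : Prop :=
  forall x y : G, S x -> S y -> ~~ adj x y.

(* The maximum size of an independent set of G exists and is m. Independent
   sets are not assumed to be finite: the upper bound rules out infinite ones. *)
Definition is_independence_number (G : sgraph) (m : nat) : Prop :=
  (exists S : set G, independent S /\ S #= `I_m) /\
  (forall S : set G, independent S -> S #<= `I_m).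

Section NonzeroComponentGraph.
Variables (F : fieldType) (V : vectType F) (n : nat) (alpha : n.-tuple V).

Definition nonzero_vector := {v : V | v != 0}.

(* coord alpha i v is the coefficient of alpha_i in v as soon as alpha is a
   basis of V *)
Definition nzc_adj : rel nonzero_vector := fun a b =>
  (a != b) &&
  [exists i : 'I_n, (coord alpha i (val a) != 0) && (coord alpha i (val b) != 0)].

Fact nzc_adj_sym : symmetric nzc_adj.
Proof.
move=> a b; rewrite /nzc_adj eq_sym; congr (_ && _).
by apply: eq_existsb => i; rewrite andbC.
Qed.

Fact nzc_adj_irrefl : irreflexive nzc_adj.
Proof. by move=> a; rewrite /nzc_adj eqxx. Qed.

Definition nzc_graph : sgraph := SGraph nzc_adj_sym nzc_adj_irrefl.

End NonzeroComponentGraph.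

(* Main.v *)
Require Import Defs.
From mathcomp Require Import all_boot all_order all_algebra.
From mathcomp Require Import classical_sets cardinality.

(** Mapping each vertex to an index in its support is injective on an
    independent set, since vertices sharing a support index are adjacent; hence
    an independent set has at most [n] elements. The basis vectors themselves
    have pairwise disjoint supports and attain the bound. *)

Set Implicit Arguments.
Unset Strict Implicit.
Unset Printing Implicit Defensive.

Import GRing.Theory.
Local Open Scope ring_scope.

Section IndependentSets.
Local Open Scope classical_set_scope.
Local Open Scope card_scope.
Variables (F : fieldType) (V : vectType F) (n : nat) (alpha : n.-tuple V).
Hypothesis alpha_basis : basis_of {:V}%VS alpha.

(** If all coordinates vanished, the expansion of [v] in the basis would be zero. *)
Lemma nonzero_coord_exists (v : nonzero_vector V) :
  exists i : 'I_n, coord alpha i (val v) != 0.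
Proof.
apply/existsP; apply: contraT; rewrite negb_exists => /forallP v0.
case/negP: (valP v); apply/eqP.
rewrite (coord_basis alpha_basis (memvf (val v))).
by apply: big1 => i _; move: (v0 i) => /negPn/eqP ->; rewrite scale0r.
Qed.

Definition support_index (v : nonzero_vector V) : 'I_n :=
  xchoose (nonzero_coord_exists v).

Lemma independent_support_index_inj (S : set (nzc_graph alpha)) :
  independent S -> {in S &, injective support_index}.
Proof.
move=> indS u v /set_mem Su /set_mem Sv eq_uv; apply/eqP.
have := indS _ _ Su Sv; rewrite /= /nzc_adj.
case: eqP => //= _ /existsP[]; exists (support_index u).
by rewrite (xchooseP (nonzero_coord_exists u)) eq_uv
  (xchooseP (nonzero_coord_exists v)).
Qed.

Lemma independent_card_le (S : set (nzc_graph alpha)) :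
  independent S -> S #<= `I_n.
Proof.
move=> /independent_support_index_inj/inj_card_eq fS.
(* Replacing [S] by its equipotent image under [support_index] reduces the bound to an inclusion of
   sets of ordinals, with no prior finiteness of [S]. *)
rewrite -(card_le_eql fS) (card_le_eqr card_II).
exact: subset_card_le.
Qed.

(** By freeness the [i]-th coordinate of this vector is 1, whereas that of the zero vector is 0. *)
Lemma basis_vector_neq0 (i : 'I_n) : alpha`_i != 0.
Proof.
apply/eqP => ai0; have := coord_free i i (basis_free alpha_basis).
by rewrite ai0 linear0 eqxx => /esym/eqP; rewrite oner_eq0.
Qed.

Definition basis_vertex (i : 'I_n) : nzc_graph alpha :=
  exist _ alpha`_i (basis_vector_neq0 i).

Lemma coord_basis_vertex (i j : 'I_n) :
  coord alpha j (val (basis_vertex i)) = (i == j)%:R.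
Proof. exact: coord_free (basis_free alpha_basis). Qed.

Lemma basis_vertex_inj : injective basis_vertex.
Proof.
move=> i j eq_ij; apply/eqP; have := coord_basis_vertex i j.
rewrite eq_ij coord_basis_vertex eqxx.
(* If [i] and [j] differed, the [j]-th coordinate of the common vertex would be both 1 and 0. *)
by case: eqP => // _ /eqP; rewrite oner_eq0.
Qed.

Lemma basis_vertices_independent : independent (range basis_vertex).
Proof.
move=> _ _ [i _ <-] [j _ <-]; apply/negP => /andP[neq_ij /existsP[k]].
(* A shared support index [k] forces [i = k = j], against the distinctness built into adjacency. *)
rewrite !coord_basis_vertex; case: (i =P k) => [ik|]; last by rewrite eqxx.
case: (j =P k) => [jk|]; last by rewrite eqxx andbF.
by rewrite ik jk eqxx in neq_ij.
Qed.

Lemma basis_vertices_card : range basis_vertex #= `I_n.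
Proof.
rewrite (card_eqr card_II); apply: inj_card_eq => i j _ _.
exact: basis_vertex_inj.
Qed.

End IndependentSets.

Theorem theorem4p5 (F : fieldType) (V : vectType F) (n : nat)
  (alpha : n.-tuple V) (V_neq0 : {:V}%VS != 0%VS)
  (alpha_basis : basis_of {:V}%VS alpha) :
  is_independence_number (nzc_graph alpha) (\dim {:V}).
Proof.
rewrite (size_basis alpha_basis); split; last exact: independent_card_le.
exists (range (basis_vertex alpha_basis))%classic; split.
  exact: basis_vertices_independent.
exact: basis_vertices_card.
Qed.
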